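(* As formal power series, with all sums over all plane partitions $\pi$, $$\sum_{\pi}q^{|\pi|_{uh}}=\prod_{k=1}^{\infty}\frac{1}{(1-q^k)^k}=\sum_{\pi}q^{|\pi|}.$$ Moreover, the pairs of statistics $(\mathrm{des}(\pi),|\pi|_{uh})$ and $(\mathrm{tr}(\pi),|\pi|)$ are also equidistributed: $$\sum_{\pi}t^{\mathrm{des}(\pi)}q^{|\pi|_{uh}}=\prod_{k=1}^{\infty}\frac{1}{(1-tq^k)^k}=\sum_{\pi}t^{\mathrm{tr}(\pi)}q^{|\pi|}.$$
   Context: A plane partition $\pi=(\pi_{ij})_{i,j\ge1}$ is a two-dimensional array of nonnegative integers with finitely many nonzero entries such that $\pi_{ij}\ge\pi_{i+1\,j}$ and $\pi_{ij}\ge\pi_{i\,j+1}$ for all $i,j$ ($i$ is the row index, $j$ the column index). Its volume is $|\pi|=\sum_{i,j}\pi_{ij}$ and its trace is $\mathrm{tr}(\pi)=\sum_i\pi_{ii}$. The descent set is $\mathrm{Des}(\pi)=\{(i,j):\pi_{ij}>\pi_{i+1\,j}\}$ and $\mathrm{des}(\pi)=|\mathrm{Des}(\pi)|$. The up-hook volume is $|\pi|_{uh}=\sum_{(i,j)\in\mathrm{Des}(\pi)}(\pi_{ij}+i-1)$. *)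

(* Defs.v *)
From HB Require Import structures.
From mathcomp Require Import all_boot all_order all_algebra.
From mathcomp Require Import finmap.
From mathcomp Require Import boolp classical_sets functions cardinality fsbigop.
From mathcomp Require Import filter.
Set Implicit Arguments.
Unset Strict Implicit.
Unset Printing Implicit Defensive.
Import GRing.Theory.
Local Open Scope classical_set_scope.
Local Open Scope ring_scope.

(* For [f : fps R], [f n] is the coefficient of degree [n]; two-variable series
   in t and q are [fps (fps R)], i.e. R[[t]][[q]], with q = [fps_var] and
   t = [fps_const fps_var]. *)

Record fps (R : Type) := Fps { fps_coef :> nat -> R }.

HB.instance Definition _ (R : Type) := [isNew for @fps_coef R].
HB.instance Definition _ (R : choiceType) := [Choice of fps R by <:].

Lemma fpsP (R : Type) (f g : fps R) : (forall n, f n = g n) -> f = g.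
Proof. by case: f g => [f] [g] /= /funext ->. Qed.

Section FpsZmod.
Variable R : zmodType.
Implicit Types f g h : fps R.

Definition fps_zero : fps R := Fps (fun _ => 0).
Definition fps_opp f : fps R := Fps (fun n => - f n).
Definition fps_add f g : fps R := Fps (fun n => f n + g n).

Fact fps_addA : associative fps_add.
Proof. by move=> f g h; apply: fpsP => n /=; rewrite addrA. Qed.
Fact fps_addC : commutative fps_add.
Proof. by move=> f g; apply: fpsP => n /=; rewrite addrC. Qed.
Fact fps_add0 : left_id fps_zero fps_add.
Proof. by move=> f; apply: fpsP => n /=; rewrite add0r. Qed.
Fact fps_addN : left_inverse fps_zero fps_opp fps_add.
Proof. by move=> f; apply: fpsP => n /=; rewrite addNr. Qed.

HB.instance Definition _ :=
  GRing.isZmodule.Build (fps R) fps_addA fps_addC fps_add0 fps_addN.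

End FpsZmod.

Section FpsRing.
Variable R : comNzRingType.
Implicit Types f g h : fps R.

Definition fps_const (c : R) : fps R := Fps (fun n => c *+ (n == 0)).
Definition fps_var : fps R := Fps (fun n => (n == 1)%:R).
Definition fps_mul f g : fps R := Fps (fun n => \sum_(i < n.+1) f i * g (n - i)%N).

(* The ring axioms are transported from polynomials by truncation. *)
Let trunc n f : {poly R} := \poly_(i < n.+1) f i.

Let truncE n f k : (k <= n)%N -> (trunc n f)`_k = f k.
Proof. by move=> kn; rewrite coef_poly ltnS kn. Qed.

Let mul_truncE n f g k : (k <= n)%N ->
  fps_mul f g k = (trunc n f * trunc n g)`_k.
Proof.
move=> kn; rewrite coefM; apply: eq_bigr => i _.
by rewrite !truncE ?(leq_trans _ kn) ?leq_subr // -ltnS.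
Qed.

Fact fps_mulC : commutative fps_mul.
Proof. by move=> f g; apply: fpsP => n; rewrite !(mul_truncE _ _ (leqnn n)) mulrC. Qed.

Let mul3_truncE n f g h :
  fps_mul (fps_mul f g) h n = (trunc n f * trunc n g * trunc n h)`_n.
Proof.
have lei (i : 'I_n.+1) : (i <= n)%N by rewrite -ltnS.
rewrite coefM /=; apply: eq_bigr => i _; congr (_ * _).
  exact: mul_truncE.
by rewrite truncE ?leq_subr.
Qed.

Fact fps_mulA : associative fps_mul.
Proof.
move=> f g h; apply: fpsP => n.
by rewrite (fps_mulC f) !mul3_truncE mulrC mulrA.
Qed.

Fact fps_mul1 : left_id (fps_const 1) fps_mul.
Proof.
move=> f; apply: fpsP => n /=; rewrite big_ord_recl /= mul1r subn0.
by rewrite big1 ?addr0 // => i _; rewrite mul0r.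
Qed.

Fact fps_mulDl : left_distributive fps_mul +%R.
Proof.
move=> f g h; apply: fpsP => n /=; rewrite -big_split.
by apply: eq_bigr => i _; rewrite mulrDl.
Qed.

Fact fps_one_neq0 : fps_const 1 != 0.
Proof. by apply/eqP => /(congr1 (fun f : fps R => f 0%N))/eqP; rewrite oner_eq0. Qed.

HB.instance Definition _ := GRing.Zmodule_isComNzRing.Build (fps R)
  fps_mulA fps_mulC fps_mul1 fps_mulDl fps_one_neq0.

End FpsRing.

Arguments fps_var {R}.

Section FpsUnitRing.
Variable R : comUnitRingType.
Implicit Types f g h : fps R.

(* The coefficients of degree at most [n] of the inverse of [f], from
   f 0 * g n = - \sum_(i < n) f (n - i) * g i for n > 0. *)
Fixpoint fps_inv_seq f n : seq R :=
  if n is m.+1 then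
    let s := fps_inv_seq f m in
    rcons s (- (f 0%N)^-1 * \sum_(i < m.+1) f (m.+1 - i)%N * s`_i)
  else [:: (f 0%N)^-1].

Definition fps_unit : {pred fps R} := fun f => f 0%N \is a GRing.unit.
Definition fps_inv f : fps R :=
  if f \in fps_unit then Fps (fun n => (fps_inv_seq f n)`_n) else f.

Let size_inv_seq f n : size (fps_inv_seq f n) = n.+1.
Proof. by elim: n => //= n IHn; rewrite size_rcons IHn. Qed.

Let nth_inv_seq f n i : (i <= n)%N -> (fps_inv_seq f n)`_i = (fps_inv_seq f i)`_i.
Proof.
elim: n => [|n IHn]; first by rewrite leqn0 => /eqP ->.
rewrite leq_eqVlt ltnS => /predU1P[-> //|lein].
by rewrite -IHn // /= nth_rcons size_inv_seq ltnS lein.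
Qed.

Fact fps_mulV : {in fps_unit, left_inverse 1 fps_inv *%R}.
Proof.
move=> f uf; rewrite /fps_inv uf mulrC; apply: fpsP => -[|n] /=.
  by rewrite big_ord1 /= divrr.
rewrite big_ord_recl /= subn0 nth_rcons size_inv_seq ltnn eqxx.
rewrite mulrA mulrN divrr // mulN1r addrC; apply/eqP; rewrite subr_eq0.
apply/eqP; rewrite [RHS](reindex_inj rev_ord_inj); apply: eq_bigr => i _ /=.
by rewrite subKn // [in RHS]nth_inv_seq // subSS leq_subr.
Qed.

Fact fps_unitPl f g : g * f = 1 -> f \in fps_unit.
Proof.
move=> /(congr1 (fun h : fps R => h 0%N)) /=; rewrite big_ord1 /= => gf1.
by apply/unitrPr; exists (g 0%N); rewrite mulrC.
Qed.

Fact fps_inv_out : {in [predC fps_unit], fps_inv =1 id}.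
Proof. by move=> f; rewrite inE /= /fps_inv => /negbTE ->. Qed.

HB.instance Definition _ :=
  GRing.ComNzRing_hasMulInverse.Build (fps R) fps_mulV fps_unitPl fps_inv_out.

End FpsUnitRing.

Section FpsInfinite.
Variable R : comNzRingType.

Definition fps_summable (I : choiceType) (A : set I) (F : I -> fps R) :=
  forall n, finite_set [set i | A i /\ F i n != 0].

(* Meaningful only for a summable family. *)
Definition fps_sum (I : choiceType) (A : set I) (F : I -> fps R) : fps R :=
  Fps (fun n => \sum_(i \in A) F i n).

Definition fps_converges (u : nat -> fps R) (f : fps R) :=
  forall n, \forall N \near \oo, u N n = f n.

Definition fps_partial_prod (u : nat -> fps R) (N : nat) : fps R :=
  \prod_(1 <= k < N.+1) u k.

Definition fps_multipliable (u : nat -> fps R) :=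
  exists f, fps_converges (fps_partial_prod u) f.

(* The product of the [u k] for k >= 1; meaningful only for a multipliable
   family. *)
Definition fps_prod (u : nat -> fps R) : fps R :=
  xget 0 (fps_converges (fps_partial_prod u)).

Lemma fps_converges_unique u f g :
  fps_converges u f -> fps_converges u g -> f = g.
Proof.
move=> uf ug; apply: fpsP => n.
have [N [<- <-]] : exists N, u N n = f n /\ u N n = g n.
  by apply: (@filter_ex _ \oo); apply: filterI; [exact: uf | exact: ug].
by [].
Qed.

End FpsInfinite.

(* Indices start at 0: [pi i j] is the entry in row i + 1 and column j + 1. *)
Definition plane_partition : set (nat -> nat -> nat) :=
  [set pi | [/\ finite_set [set ij : nat * nat | pi ij.1 ij.2 != 0%N],
              forall i j, (pi i.+1 j <= pi i j)%N
            & forall i j, (pi i j.+1 <= pi i j)%N]].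

Section Statistics.
Variable pi : nat -> nat -> nat.

Definition volume : nat := \sum_(ij \in [set: nat * nat]) pi ij.1 ij.2.

Definition trace : nat := \sum_(i \in [set: nat]) pi i i.

Definition Des : set (nat * nat) := [set ij | (pi ij.1.+1 ij.2 < pi ij.1 ij.2)%N].

Definition des : nat := #|` fset_set Des|.

(* The summand pi_ij + i - 1 becomes [pi i j + i] for a row index from 0. *)
Definition uh_volume : nat := \sum_(ij \in Des) (pi ij.1 ij.2 + ij.1)%N.

End Statistics.

(* Main.v *)
Require Import Defs.
From mathcomp Require Import all_boot all_order all_algebra.
From mathcomp Require Import boolp classical_sets functions cardinality fsbigop.
From mathcomp Require Import zify.
Set Implicit Arguments.
Unset Strict Implicit.
Unset Printing Implicit Defensive.
Import GRing.Theory.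
Local Open Scope classical_set_scope.

(** Each pair of statistics has its own bijection [pi |-> a] from plane
    partitions to finitely supported matrices of natural numbers that sends
    it to (sum of the a_ij, sum of the a_ij (i + j + 1)), indices starting
    at 0. The generating function of these matrices is the product, since the
    cells with i + j + 1 = k are k in number.

    For descents, a_il counts the descents of row i with value l + 1. Given the
    row below, nu, and the multiset mu of descent values, the row is recovered
    greedily from the left, its next entry being the larger of the largest
    unused part of mu and the current entry of nu.

    For trace and volume, the diagonals of pi are the first row and column of a
    grid of partitions, each new partition kappa being given by the local rule
    kappa_r = max(mu_{r+1}, nu_{r+1}) + min(mu_r, nu_r) - lambda_{r+1}, and
    a_ij = lambda_0 - max(mu_0, nu_0) (the RSK correspondence by toggles); then
    the size of the partition at (i, j) is the sum of the entries of a weakly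
    to the south-east of (i, j). *)

(** * Finitely supported matrices and their weight *)

Definition in_box n (a : nat -> nat -> nat) :=
  forall i j, (n <= i) || (n <= j) -> a i j = 0.

Definition finsupp_mx : set (nat -> nat -> nat) := [set a | exists n, in_box n a].

Lemma in_boxW m n a : m <= n -> in_box m a -> in_box n a.
Proof. by move=> mn am i j nij; apply: am; lia. Qed.

Lemma finite_support_box (a : nat -> nat -> nat) :
  finite_set [set ij : nat * nat | a ij.1 ij.2 != 0] <-> finsupp_mx a.
Proof.
split=> [/finite_seqP[s sE]|[n an]].
  exists (\max_(ij <- s) (ij.1 + ij.2).+1) => i j nij; apply/eqP.
  apply: contraPT nij => aij; apply/negP; rewrite negb_or -!ltnNge.
  have sij : (i, j) \in s by have : [set` s] (i, j) by rewrite -sE.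
  have := @leq_bigmax_seq _ s xpredT (fun ij : nat * nat => (ij.1 + ij.2).+1) _ sij isT.
  by move=> /=; lia.
apply: (@sub_finite_set _ _ (`I_n `*` `I_n)); last first.
  by apply: finite_setX; apply: finite_II.
move=> [i j] /= aij; split=> /=; rewrite ltnNge; apply: contraNN aij => nij;
  by apply/eqP/an; rewrite nij ?orbT.
Qed.

Lemma fsum_lt n (f : nat -> nat) : (forall i, n <= i -> f i = 0) ->
  (\sum_(i \in [set: nat]) f i)%R = \sum_(i < n) f i.
Proof.
move=> fn; rewrite [RHS](fsbig_ord addn); apply/esym/fsbig_widen => // i [_] /= ni.
by apply: fn; lia.
Qed.

Lemma fsum_box n (f : nat -> nat -> nat) : in_box n f ->
  (\sum_(ij \in [set: nat * nat]) f ij.1 ij.2)%R = \sum_(i < n) \sum_(j < n) f i j.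
Proof.
move=> fn; under [RHS]eq_bigr do rewrite fsbig_ord.
rewrite [RHS](fsbig_ord addn n (fun i => \big[addn/0]_(j \in `I_n) f i j)).
rewrite pair_fsbig; [|exact: finite_II|exact: finite_II].
by apply/esym/fsbig_widen => // -[i j] [_] /= nij; apply: fn; lia.
Qed.

(** [A] may be infinite: restricting to the finite support first reduces this to [fsbigID]. *)
Lemma fsumID (V : nmodType) (I : choiceType) (A B : set I) (F : I -> V) :
  finite_set (A `&` F @^-1` [set~ 0%R]) ->
  (\sum_(i \in A) F i = \sum_(i \in A `&` B) F i + \sum_(i \in A `&` ~` B) F i)%R.
Proof.
move=> finF; rewrite fsbig_supp (fsbigID B) //= [_ `&` _ `&` B]setIAC [_ `&` _ `&` ~` B]setIAC.
by rewrite -!fsbig_supp.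
Qed.

Definition weight (a : nat -> nat -> nat) : nat :=
  (\sum_(ij \in [set: nat * nat]) a ij.1 ij.2 * (ij.1 + ij.2).+1)%R.

Lemma volume_box n a : in_box n a -> volume a = \sum_(i < n) \sum_(j < n) a i j.
Proof. exact: fsum_box. Qed.

Lemma weight_box n a : in_box n a ->
  weight a = \sum_(i < n) \sum_(j < n) a i j * (i + j).+1.
Proof.
by move=> an; apply: (fsum_box (f := fun i j => a i j * (i + j).+1)) => i j /an ->.
Qed.

Lemma leq_weight a i j : finsupp_mx a -> a i j * (i + j).+1 <= weight a.
Proof.
move=> [n an]; rewrite (weight_box an).
case: (boolP ((n <= i) || (n <= j))) => [/an -> //|].
rewrite negb_or -!ltnNge => /andP[ni nj].
rewrite (bigD1 (Ordinal ni)) //= (bigD1 (Ordinal nj)) //=; lia.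
Qed.

(** A nonzero entry at (i, j) costs at least i + j + 1, so a matrix of weight [n] lives in the n by
    n box and has entries at most [n]. *)
Lemma finite_weight n : finite_set [set a | finsupp_mx a /\ weight a = n].
Proof.
pose ext (f : {ffun 'I_n * 'I_n -> 'I_n.+1}) (i j : nat) : nat :=
  if insub i is Some i' then if insub j is Some j' then f (i', j') else 0 else 0.
apply: (@sub_finite_set _ _ (range ext)); last exact/finite_image/finite_finset.
move=> a [fa wa]; have lea i j : a i j * (i + j).+1 <= n by rewrite -wa leq_weight.
exists [ffun ij : 'I_n * 'I_n => inord (a ij.1 ij.2)] => //.
apply/funext => i; apply/funext => j; rewrite /ext; have := lea i j.
case: insubP => [i' _ <-|]; last by case: (a i j) => // x; nia.
case: insubP => [j' _ <-|]; last by case: (a i' j) => // x; nia.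
by rewrite ffunE /= => ?; rewrite inordK //; nia.
Qed.

Definition single (c : nat * nat) (i j : nat) : nat := ((i, j) == c).

Definition add_single c (a : nat -> nat -> nat) i j := a i j + single c i j.

Lemma fsum_single (g : nat * nat -> nat) c :
  (\sum_(ij \in [set: nat * nat]) single c ij.1 ij.2 * g ij = g c)%R.
Proof.
rewrite -[RHS](fsbig_set1 addn) /=.
rewrite -(@fsbig_widen _ _ _ _ [set c]) //; last first.
  move=> -[i j] [_] /= ne; rewrite /single /=; case: eqP => // _; exact: mul0r.
by rewrite !fsbig_set1 /single -surjective_pairing eqxx; exact: mul1r.
Qed.

Lemma fsum_add_single (g : nat * nat -> nat) c a : finsupp_mx a ->
  (\sum_(ij \in [set: nat * nat]) add_single c a ij.1 ij.2 * g ij =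
   \sum_(ij \in [set: nat * nat]) a ij.1 ij.2 * g ij + g c)%R.
Proof.
move=> /finite_support_box fa; rewrite -[in RHS](fsum_single g c).
(* Splitting the sum needs a finite index set; [D] contains the supports of both summands. *)
pose D := [set ij : nat * nat | a ij.1 ij.2 != 0] `|` [set c].
have finD : finite_set D by rewrite finite_setU.
have out (i j : nat) : ~ D (i, j) -> a i j = 0 /\ single c i j = 0.
  move=> /not_orP[/= /negP]; rewrite negbK => /eqP -> /eqP/negbTE.
  by rewrite /single => ->.
rewrite -!(@fsbig_widen _ _ _ _ D setT) //; last 3 first.
- by move=> [i j] [_ /out[/= _ ->]]; exact: mul0r.
- by move=> [i j] [_ /out[/= -> _]]; exact: mul0r.
- by move=> [i j] [_ /out[/= aij ij]]; rewrite /add_single aij ij; exact: mul0r.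
rewrite -fsbig_split //; apply: eq_fsbigr => ij _.
exact: mulrDl.
Qed.

Lemma volume_add_single c a : finsupp_mx a -> volume (add_single c a) = (volume a).+1.
Proof.
move=> fa; have := fsum_add_single (fun=> 1) c fa.
under eq_fsbigr do rewrite [(_ * _)%R]muln1.
by under [in RHS]eq_fsbigr do rewrite [(_ * _)%R]muln1; rewrite [(_ + _)%R]addn1.
Qed.

Lemma weight_add_single c a : finsupp_mx a ->
  weight (add_single c a) = (c.1 + c.2).+1 + weight a.
Proof. by move=> fa; rewrite /weight fsum_add_single // addrC. Qed.

(** * Generating function of the matrices *)

Definition supported_on (s : seq (nat * nat)) : set (nat -> nat -> nat) :=
  [set a | forall i j, (i, j) \notin s -> a i j = 0].

Lemma supported_on_finsupp s : supported_on s `<=` finsupp_mx.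
Proof.
move=> a sa; apply/finite_support_box/(sub_finite_set _ (finite_seq s)) => -[i j] /=.
by apply: contraNT => /sa ->.
Qed.

(** Built one antidiagonal at a time: passing from [k] to [k.+1] adjoins the [k.+1] cells with i + j
    + 1 = k + 1, which account for the factor of index [k.+1] in the product. *)
Fixpoint antidiagonal_cells N : seq (nat * nat) :=
  if N is k.+1 then [seq (i, k - i) | i <- iota 0 k.+1] ++ antidiagonal_cells k
  else [::].

Lemma mem_antidiagonal_cells N i j : ((i, j) \in antidiagonal_cells N) = (i + j < N).
Proof.
elim: N => // k IHk; rewrite /antidiagonal_cells -/antidiagonal_cells mem_cat IHk.
apply/idP/idP => [/orP[/mapP[i']|]|].
- by rewrite mem_iota => ? [-> ->]; lia.
- by lia.
- rewrite ltnS leq_eqVlt => /orP[/eqP kE|->]; last by rewrite orbT.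
  apply/orP; left; apply/mapP; exists i; first by rewrite mem_iota; lia.
  by congr (_, _); lia.
Qed.

Section GeneratingFunction.
Local Open Scope ring_scope.
Variables (R : comUnitRingType) (tau : R).

(** The mark [tau] lies in the coefficient ring: [1] gives the series in q alone, [fps_var] the
    series in t and q. *)
Definition monomial m w : fps R := fps_const tau ^+ m * fps_var ^+ w.

Lemma monomialD m m' w w' :
  monomial (m + m') (w + w') = monomial m w * monomial m' w'.
Proof. by rewrite /monomial !exprD mulrACA. Qed.

Lemma fps_const_mul (c : R) (f : fps R) n : (fps_const c * f) n = c * f n.
Proof.
rewrite [LHS]big_ord_recl /= subn0 mulr1n big1 ?addr0 // => i _.
by rewrite mulr0n mul0r.
Qed.

Lemma fps_var_mul (f : fps R) n : (fps_var * f) n = if n is m.+1 then f m else 0.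
Proof.
case: n => [|n]; first by rewrite [LHS]big_ord1 /= mul0r.
rewrite [LHS]big_ord_recl big_ord_recl /= mul0r add0r mul1r subSS subn0.
by rewrite big1 ?addr0 // => i _; rewrite mul0r.
Qed.

Lemma monomial_mul m w (f : fps R) n :
  (monomial m w * f) n = if (w <= n)%N then tau ^+ m * f (n - w)%N else 0.
Proof.
have constX g k : (fps_const tau ^+ m * g) k = tau ^+ m * g k.
  by elim: m => [|p IHp]; rewrite ?expr0 ?mul1r // !exprS -!mulrA fps_const_mul IHp.
rewrite /monomial -mulrA constX; elim: w n => [|w IHw] n.
  by rewrite expr0 mul1r subn0.
rewrite exprS -mulrA fps_var_mul; case: n => [|n]; first by rewrite mulr0.
exact: IHw.
Qed.

Definition matrix_monomial a := monomial (volume a) (weight a).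

Lemma monomial_coef m w n : monomial m w n = tau ^+ m *+ (w == n).
Proof.
rewrite -[monomial m w]mulr1 monomial_mul /=.
case: leqP => wn; last by rewrite gtn_eqF.
by rewrite subn_eq0 eqn_leq wn /= mulrnAr mulr1.
Qed.

Lemma finite_monomial_support (I : choiceType) (A : set I) (F : I -> fps R) n :
  fps_summable A F -> finite_set (A `&` (fun i => F i n) @^-1` [set~ 0]).
Proof. by move=> /(_ n); apply: sub_finite_set => i [Ai /= /eqP]. Qed.

Lemma matrix_monomial_neq0 a n : matrix_monomial a n != 0 -> weight a = n.
Proof. by rewrite monomial_coef; case: (weight a =P n) => // _ /eqP[]. Qed.

Lemma summable_finsupp : fps_summable finsupp_mx matrix_monomial.
Proof.
by move=> n; apply: sub_finite_set (finite_weight n) => a [fa /matrix_monomial_neq0].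
Qed.

Lemma summable_supported s : fps_summable (supported_on s) matrix_monomial.
Proof.
move=> n; apply: sub_finite_set (summable_finsupp n) => a [/supported_on_finsupp].
by split.
Qed.

Lemma fps_coefD (f g : fps R) n : (f + g) n = f n + g n.
Proof. by []. Qed.

Lemma fps_sumE (I : choiceType) (A : set I) (F : I -> fps R) n :
  fps_sum A F n = \sum_(i \in A) F i n.
Proof. by []. Qed.

Lemma fps_sum_monomial (I : choiceType) (A : set I) (F : I -> fps R) m w :
  fps_summable A F ->
  fps_sum A (fun i => monomial m w * F i) = monomial m w * fps_sum A F.
Proof.
move=> sumF; apply: fpsP => n; rewrite monomial_mul !fps_sumE.
under eq_fsbigr do rewrite monomial_mul.
case: leqP => wn; last by rewrite fsbig1.
by rewrite full_fsbig_distrr //; exact: finite_monomial_support.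
Qed.

Definition supported_gf s := fps_sum (supported_on s) matrix_monomial.

Lemma supported_gf_nil : supported_gf [::] = 1.
Proof.
rewrite /supported_gf; have -> : supported_on [::] = [set fun=> fun=> 0%N].
  apply/seteqP; split=> [a a0|a -> //]; apply/funext => i; apply/funext => j.
  exact: a0.
apply: fpsP => n; rewrite fps_sumE fsbig_set1 [LHS]monomial_coef.
have b0 : in_box 0 (fun=> fun=> 0%N) by [].
by rewrite (volume_box b0) (weight_box b0) !big_ord0 eq_sym.
Qed.

(* Either the entry at [c] vanishes, or it can be decremented. *)
Lemma supported_gf_cons c s : c \notin s ->
  supported_gf (c :: s) = supported_gf s + monomial 1 (c.1 + c.2).+1 * supported_gf (c :: s).
Proof.
move=> cs; rewrite -fps_sum_monomial; last exact: summable_supported.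
apply: fpsP => n; rewrite fps_coefD !fps_sumE.
rewrite (fsumID [set a | a c.1 c.2 = 0%N]); last first.
  exact/finite_monomial_support/summable_supported.
congr (_ + _).
  apply: eq_fsbigl; apply/seteqP; split=> a /=.
    move=> [sa ac] i j ijs; case: ((i, j) =P c) ac => [<- //|/eqP ijc _].
    by apply: sa; rewrite inE negb_or ijc.
  move=> sa; split=> [i j|]; first by rewrite inE negb_or => /andP[_ /sa].
  by apply: sa; rewrite -surjective_pairing.
rewrite (reindex_fsbig (add_single c) (supported_on (c :: s))).
  apply: eq_fsbigr => a; rewrite inE => /supported_on_finsupp fa.
  rewrite /matrix_monomial volume_add_single // weight_add_single //.
  by rewrite -[(volume a).+1]add1n monomialD.
split.
- move=> a sa /=; split=> [i j ijs|]; last first.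
    by rewrite /add_single /single -surjective_pairing eqxx addn1.
  rewrite /add_single sa // /single; move: ijs; rewrite inE negb_or.
  by case/andP => /negbTE ->.
- move=> a b _ _ ab; apply/funext => i; apply/funext => j.
  by have := congr1 (fun f => f i j) ab; exact: addIn.
- move=> a [sa /eqP ac]; exists (fun i j => a i j - single c i j)%N.
    by move=> i j /sa /= ->.
  apply/funext => i; apply/funext => j; rewrite /add_single /single.
  by apply: subnK; case: eqP => // ijc; move: ac; rewrite -ijc lt0n.
Qed.

(** All cells of [s1] carry the same monomial, and by [supported_gf_cons] each multiplication by
    [1 - monomial 1 k] removes one of them. *)
Lemma supported_gf_cat k s1 s2 :
  uniq s1 -> (forall c, c \in s1 -> (c.1 + c.2).+1 = k /\ c \notin s2) ->
  supported_gf (s1 ++ s2) * (1 - monomial 1 k) ^+ size s1 = supported_gf s2.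
Proof.
elim: s1 => [|c s IHs] /=; first by rewrite mulr1.
move=> /andP[cs us] s12; rewrite exprS mulrA.
have [wc cs2] : (c.1 + c.2).+1 = k /\ c \notin s2 by apply: s12; rewrite mem_head.
rewrite mulrBr mulr1 {1}supported_gf_cons ?mem_cat ?negb_or ?cs // wc.
rewrite mulrC -addrA [_ * supported_gf _]mulrC subrr addr0 mulrC.
by apply: IHs => // c' c's; apply: s12; rewrite inE c's orbT.
Qed.

Definition macmahon_factor k := 1 / (1 - monomial 1 k) ^+ k.

Lemma partial_prod_gf N :
  fps_partial_prod macmahon_factor N = supported_gf (antidiagonal_cells N).
Proof.
rewrite /fps_partial_prod; elim: N => [|N IHN].
  by rewrite big_geq // supported_gf_nil.
(* A series is a unit as soon as its constant coefficient is; here that coefficient is 1. *)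
have unit_factor : (1 - monomial 1 N.+1) ^+ N.+1 \is a GRing.unit.
  rewrite unitrX //.
  have -> : (1 - monomial 1 N.+1 \is a GRing.unit) =
    ((1 - monomial 1 N.+1 : fps R) 0%N \is a GRing.unit) by [].
  have -> : (1 - monomial 1 N.+1 : fps R) 0%N = 1 - monomial 1 N.+1 0%N by [].
  by rewrite monomial_coef subr0 unitr1.
rewrite big_nat_recr // IHN [LHS]/= /macmahon_factor mulrA mulr1; apply: (canLR (mulrK unit_factor)).
symmetry; pose s := [seq (i, N - i)%N | i <- iota 0 N.+1].
have size_s : size s = N.+1 by rewrite size_map size_iota.
rewrite -[in X in _ ^+ X]size_s; apply: supported_gf_cat.
  by rewrite map_inj_uniq ?iota_uniq // => i j [].
move=> c /mapP[i]; rewrite mem_iota => iN ->.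
by rewrite mem_antidiagonal_cells /=; lia.
Qed.

(** The coefficient of degree [n] is final from [N = n] on, because a matrix of weight [n] is
    supported on the cells with i + j < n. *)
Lemma converges_prod_gf :
  fps_converges (fps_partial_prod macmahon_factor) (fps_sum finsupp_mx matrix_monomial).
Proof.
move=> n; exists n => // N /= nN; rewrite partial_prod_gf !fps_sumE.
apply: fsbig_widen; first exact: supported_on_finsupp.
move=> a [fa na] /=; apply/eqP; apply: contra_notT na => /matrix_monomial_neq0 wa i j.
rewrite mem_antidiagonal_cells => ijN; have := leq_weight i j fa; rewrite wa.
by case: (a i j) => // x; nia.
Qed.

Lemma fps_prod_gf :
  fps_multipliable macmahon_factor /\ fps_prod macmahon_factor = fps_sum finsupp_mx matrix_monomial.
Proof.
have mult : fps_multipliable macmahon_factor by exists (fps_sum finsupp_mx matrix_monomial);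
  exact: converges_prod_gf.
by split=> //; apply: fps_converges_unique (xgetPex 0 mult) converges_prod_gf.
Qed.

(** Reduces each half of the theorem to a bijection with matrices that carries the pair of
    statistics to ([volume], [weight]). *)
Lemma gf_bij (A : set (nat -> nat -> nat)) (stat1 stat2 : (nat -> nat -> nat) -> nat)
    (phi : (nat -> nat -> nat) -> (nat -> nat -> nat)) :
  set_bij A finsupp_mx phi ->
  (forall a, A a -> volume (phi a) = stat1 a /\ weight (phi a) = stat2 a) ->
  fps_summable A (fun a => monomial (stat1 a) (stat2 a)) /\
  fps_sum A (fun a => monomial (stat1 a) (stat2 a)) = fps_prod macmahon_factor.
Proof.
move=> phi_bij stat_phi.
have monE a : A a -> monomial (stat1 a) (stat2 a) = matrix_monomial (phi a).
  by move=> /stat_phi[<- <-].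
split=> [n|].
  have inj_phi : {in [set a | A a /\ monomial (stat1 a) (stat2 a) n != 0] &, injective phi}.
    by move=> a b; rewrite !inE => -[Aa _] [Ab _]; apply: (set_bij_inj phi_bij); rewrite inE.
  rewrite -(eq_finite_set (inj_card_eq inj_phi)).
  apply: sub_finite_set (summable_finsupp n) => _ [a [Aa na] <-].
  by split; [exact: (set_bij_sub phi_bij) | rewrite -monE].
rewrite fps_prod_gf.2; apply: fpsP => n; rewrite !fps_sumE [RHS](reindex_fsbig phi A) //.
by apply: eq_fsbigr => a; rewrite inE => /monE ->.
Qed.

End GeneratingFunction.

(** * Rows with prescribed descents *)

Definition nonincreasing_seq (f : nat -> nat) := forall j, f j.+1 <= f j.

Lemma nonincreasing_leq f i j : nonincreasing_seq f -> i <= j -> f j <= f i.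
Proof.
move=> fdec /subnKC <-; elim: (j - i) => [|k IHk]; first by rewrite addn0.
by rewrite addnS (leq_trans (fdec _)).
Qed.

Lemma plane_partitionP pi : plane_partition pi <->
  [/\ finsupp_mx pi, forall i j, pi i.+1 j <= pi i j & forall i, nonincreasing_seq (pi i)].
Proof. by split=> -[/finite_support_box fpi dec1 dec2]. Qed.

Definition descent_count (lam nu : nat -> nat) v n :=
  \sum_(j < n) ((lam j == v) && (nu j < lam j)).

(* At the first column where two rows differ, the larger entry is a descent
   that the row with the smaller entry cannot match further right. *)
Lemma row_leq lam lam' nu n j :
  nonincreasing_seq lam -> (forall k, n <= k -> lam' k = 0) ->
  (forall k, nu k <= lam k) ->
  (forall v, 0 < v -> descent_count lam nu v n = descent_count lam' nu v n) ->
  (forall k, k < j -> lam k = lam' k) -> lam' j <= lam j.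
Proof.
move=> dec fin' ge eq_count eq_lt; rewrite leqNgt; apply/negP => lt_j.
have jn : j < n by rewrite ltnNge; apply/negP => /fin' lam'0; rewrite lam'0 in lt_j.
have := eq_count (lam' j) (leq_trans (ltn0Sn _) lt_j); rewrite /descent_count.
rewrite -!(big_mkord xpredT (fun k => nat_of_bool ((_ k == lam' j) && (nu k < _ k)))).
rewrite !(big_cat_nat (leq0n j) (ltnW jn)) /=.
rewrite (eq_big_nat _ _ (F2 := fun k => (lam' k == lam' j) && (nu k < lam' k) : nat)); last first.
  by move=> k /andP[_ kj]; rewrite eq_lt.
rewrite [X in _ + X = _]big_nat_cond [X in _ + X = _]big1 ?addn0; last first.
  move=> k /andP[/andP[jk _] _]; have := nonincreasing_leq dec jk.
  by case: eqP => // ->; lia.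
rewrite [X in _ = _ + X]big_ltn // eqxx (leq_ltn_trans (ge j) lt_j) /=; lia.
Qed.

Lemma row_inj lam lam' nu n :
  nonincreasing_seq lam -> nonincreasing_seq lam' ->
  (forall k, n <= k -> lam k = 0) -> (forall k, n <= k -> lam' k = 0) ->
  (forall k, nu k <= lam k) -> (forall k, nu k <= lam' k) ->
  (forall v, 0 < v -> descent_count lam nu v n = descent_count lam' nu v n) ->
  lam = lam'.
Proof.
move=> dec dec' fin fin' ge ge' eq_count; apply/funext => j.
have [k] := ubnP j; elim: k j => // k IHk j; rewrite ltnS => jk.
have IHj i : i < j -> lam i = lam' i by move=> ij; apply: IHk; lia.
apply/eqP; rewrite eqn_leq (@row_leq lam lam' nu n) // andbT.
by apply: (@row_leq lam' lam nu n) => // [v|i] ?; rewrite (eq_count, IHj).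
Qed.

Fixpoint remaining_parts (mu : seq nat) (nu : nat -> nat) j :=
  if j is k.+1 then
    let s := remaining_parts mu nu k in if nu k < head 0 s then behead s else s
  else mu.

Definition add_row mu nu j := maxn (head 0 (remaining_parts mu nu j)) (nu j).

Section AddRow.
Variables (mu : seq nat) (nu : nat -> nat) (n : nat).
Hypotheses (mu_sorted : sorted geq mu) (mu_gt0 : all (ltn 0) mu).
Hypotheses (nu_dec : nonincreasing_seq nu) (nu_fin : forall k, n <= k -> nu k = 0).

Lemma add_row_geq j : nu j <= add_row mu nu j.
Proof. exact: leq_maxr. Qed.

Lemma remaining_parts_sorted j : sorted geq (remaining_parts mu nu j).
Proof.
by elim: j => //= j IHj; case: ifP => // _; case: remaining_parts IHj => //= x s /path_sorted.
Qed.

Lemma remaining_parts_gt0 j : all (ltn 0) (remaining_parts mu nu j).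
Proof.
by elim: j => //= j IHj; case: ifP => // _; case: remaining_parts IHj => //= x s /andP[].
Qed.

Lemma add_row_nonincreasing : nonincreasing_seq (add_row mu nu).
Proof.
move=> j; rewrite /add_row geq_max !leq_max nu_dec orbT andbT.
apply/orP; left; rewrite /=; case: ifP => // _.
by have := remaining_parts_sorted j; case: remaining_parts => // x [|y s] //= /andP[].
Qed.

(** From column [n] on [nu] vanishes while the parts are positive, so each column consumes a part
    until none is left. *)
Lemma size_remaining_parts k : size (remaining_parts mu nu (n + k)) <= size mu - k.
Proof.
elim: k => [|k IHk]; rewrite ?addn0 ?addnS ?subn0 /=.
  elim: n => //= m IHm; case: ifP => // _; rewrite size_behead; lia.
rewrite nu_fin ?leq_addr //; case: ifP; first by rewrite size_behead; lia.
have := remaining_parts_gt0 (n + k); case: remaining_parts IHk => //= x s _ /andP[].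
by rewrite lt0n => /negbTE ->.
Qed.

Lemma remaining_parts_nil j : n + size mu <= j -> remaining_parts mu nu j = [::].
Proof.
move=> nj; have := size_remaining_parts (j - n); rewrite subnKC; last by lia.
by case: remaining_parts => //= *; lia.
Qed.

Lemma add_row_eq0 j : n + size mu <= j -> add_row mu nu j = 0.
Proof. by move=> nj; rewrite /add_row remaining_parts_nil // nu_fin //; lia. Qed.

Lemma count_remaining_parts v j :
  count_mem v (remaining_parts mu nu j) + descent_count (add_row mu nu) nu v j =
  count_mem v mu.
Proof.
rewrite /descent_count; elim: j => [|j IHj]; first by rewrite big_ord0 addn0.
rewrite big_ord_recr /= -[RHS]IHj /add_row.
case: (ltnP (nu j) (head 0 _)) => [|le_nu]; last by rewrite ltnn andbF addn0.
case: remaining_parts => //= x s ->; rewrite andbT; lia.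
Qed.

Lemma descent_count_add_row v j : n + size mu <= j ->
  descent_count (add_row mu nu) nu v j = count_mem v mu.
Proof. by move=> nj; rewrite -(count_remaining_parts v j) remaining_parts_nil. Qed.

End AddRow.

(** * The descent matrix of a plane partition *)

Definition descent_mx (pi : nat -> nat -> nat) i l : nat :=
  (\sum_(j \in [set: nat]) ((pi i j == l.+1) && (pi i.+1 j < pi i j) : nat)%N)%R.

Lemma descent_mx_box pi n i l : in_box n pi ->
  descent_mx pi i l = descent_count (pi i) (pi i.+1) l.+1 n.
Proof. by move=> pin; apply: fsum_lt => j nj; rewrite pin ?nj ?orbT. Qed.

Lemma sum_Des pi n (f : nat * nat -> nat) : in_box n pi ->
  (\sum_(ij \in Des pi) f ij)%R =
  \sum_(i < n) \sum_(j < n) (pi i.+1 j < pi i j) * f (i : nat, j : nat).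
Proof.
move=> pin; rewrite fsbig_mkcond /=.
rewrite -(fsum_box (f := fun i j => (pi i.+1 j < pi i j) * f (i, j))); last first.
  by move=> i j /pin ->.
apply: eq_fsbigr => -[i j] _; rewrite /patch.
case: ifPn => [|/negP]; rewrite inE /Des /= => H; first by rewrite H mul1n.
by move/negP/negbTE: H => ->.
Qed.

Lemma des_sum pi : finsupp_mx pi -> des pi = (\sum_(ij \in Des pi) 1%N)%R.
Proof.
move=> [n pin]; rewrite fsbig_finite; first by rewrite [RHS]sum1_size.
apply: sub_finite_set ((finite_support_box pi).2 (ex_intro _ n pin)) => -[i j] /=.
by rewrite /Des /= -lt0n; exact: leq_ltn_trans.
Qed.

(** One bound for both shape and entries, since the rows of [descent_mx] are indexed by rows of [pi]
    and its columns by values of [pi]. *)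
Lemma plane_partition_box pi : plane_partition pi ->
  exists n, in_box n pi /\ forall i j, pi i j <= n.
Proof.
move=> /plane_partitionP[[n pin] dec1 dec2]; exists (maxn n (pi 0 0)).
split; first by apply: in_boxW pin; lia.
move=> i j; apply: leq_trans (leq_maxr _ _).
apply: leq_trans (nonincreasing_leq (dec2 i) (leq0n j)) _.
exact: (@nonincreasing_leq (pi^~ 0) 0 i).
Qed.

Lemma in_box_descent_mx pi n : in_box n pi -> (forall i j, pi i j <= n) ->
  in_box n (descent_mx pi).
Proof.
move=> pin len i l nil; rewrite (descent_mx_box i l pin); apply: big1 => j _.
case: eqP => // pil; case/orP: nil => [ni|nl]; last by have := len i j; lia.
by rewrite pin ?ni // in pil.
Qed.

(** Double counting: in each row [g] is summed over the descents, grouped by value on the left and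
    taken column by column on the right. *)
Lemma sum_descent_mx pi n (g : nat -> nat -> nat) :
  in_box n pi -> (forall i j, pi i j <= n) ->
  \sum_(i < n) \sum_(l < n) descent_mx pi i l * g i l =
  \sum_(i < n) \sum_(j < n) (pi i.+1 j < pi i j) * g i (pi i j).-1.
Proof.
move=> pin len; apply: eq_bigr => i _.
under eq_bigr do rewrite (descent_mx_box _ _ pin) big_distrl.
rewrite exchange_big /=; apply: eq_bigr => j _.
case: ltnP => [lt_pi|_]; last by rewrite big1 // => l _; rewrite andbF.
have lt_n : (pi i j).-1 < n by have := len i j; lia.
rewrite (bigD1 (Ordinal lt_n)) //= prednK ?eqxx; last by lia.
rewrite big1 ?addn0 // => l /eqP ne; case: eqP => // pil; case: ne.
by apply: val_inj; rewrite /= pil.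
Qed.

Lemma volume_descent_mx pi : plane_partition pi -> volume (descent_mx pi) = des pi.
Proof.
move=> Ppi; have [n [pin len]] := plane_partition_box Ppi.
rewrite des_sum; last by exists n.
rewrite (sum_Des _ pin) (volume_box (in_box_descent_mx pin len)).
rewrite -(sum_descent_mx (fun=> fun=> 1) pin len).
by apply: eq_bigr => i _; apply: eq_bigr => l _; rewrite muln1.
Qed.

(** A descent of value p in row i is recorded in cell (i, p - 1), of weight i + p, which is its
    share of the up-hook volume. *)
Lemma weight_descent_mx pi : plane_partition pi -> weight (descent_mx pi) = uh_volume pi.
Proof.
move=> Ppi; have [n [pin len]] := plane_partition_box Ppi.
rewrite [RHS](sum_Des _ pin) (weight_box (in_box_descent_mx pin len)).
rewrite (sum_descent_mx (fun i l => (i + l).+1) pin len).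
by apply: eq_bigr => i _; apply: eq_bigr => j _ /=; case: ltnP => //; lia.
Qed.

Lemma descent_mx_inj : {in plane_partition &, injective descent_mx}.
Proof.
move=> pi pi'; rewrite !inE => /[dup] Ppi /plane_partitionP[[m pim] dec1 dec2].
move=> /plane_partitionP[[m' pim'] dec1' dec2'] eq_mx.
pose n := maxn m m'; have pin : in_box n pi by apply: in_boxW pim; lia.
have pin' : in_box n pi' by apply: in_boxW pim'; lia.
(* Rows are compared upwards from the zero row [n], each being determined by the row below and its
   own descents. *)
suff eq_row k : pi (n - k) = pi' (n - k).
  apply/funext => i; have [ni|ni] := leqP n i; last first.
    by rewrite -[i](subKn (ltnW ni)) eq_row.
  by apply/funext => j; rewrite pin ?pin' ?ni.
elim: k => [|k IHk]; first by apply/funext => j; rewrite pin ?pin' ?subn0 ?leqnn.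
have [nk|kn] := leqP n k; first by have -> : n - k.+1 = n - k by lia.
have eS : (n - k.+1).+1 = n - k by lia.
apply: (@row_inj _ _ (pi (n - k)) n) => //.
- by move=> j nj; rewrite pin // nj orbT.
- by move=> j nj; rewrite pin' // nj orbT.
- by move=> j; rewrite -eS.
- by move=> j; rewrite IHk -eS.
move=> [//|v] _; rewrite -eS -descent_mx_box // eq_mx eS IHk -eS.
exact: descent_mx_box.
Qed.

(** * Plane partition with a given descent matrix *)

Definition row_parts (D : nat -> nat) n :=
  sort geq (flatten [seq nseq (D l) l.+1 | l <- iota 0 n]).

Lemma row_parts_sorted D n : sorted geq (row_parts D n).
Proof. by apply: sort_sorted => x y; exact: leq_total. Qed.

Lemma row_parts_gt0 D n : all (ltn 0) (row_parts D n).
Proof.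
apply/allP => x; rewrite mem_sort => /flattenP[_ /mapP[l _ ->]].
by rewrite mem_nseq => /andP[_ /eqP ->].
Qed.

Lemma count_row_parts D n l : (forall l, n <= l -> D l = 0) ->
  count_mem l.+1 (row_parts D n) = D l.
Proof.
move=> Dn; rewrite count_sort count_flatten -map_comp sumnE big_map.
under eq_bigr do rewrite /= count_nseq /= eqSS.
have [nl|ln] := leqP n l.
  rewrite Dn // big_seq big1 // => k; rewrite mem_iota => kn.
  by case: eqP => //; lia.
rewrite (bigD1_seq l) ?mem_iota ?iota_uniq //= eqxx mul1n big1 ?addn0 // => k.
by move=> /negbTE ->.
Qed.

(* [rows_from_below D n k] is the row of index [n - k]. *)
Fixpoint rows_from_below (D : nat -> nat -> nat) n k : nat -> nat :=
  if k is k'.+1 then add_row (row_parts (D (n - k)) n) (rows_from_below D n k')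
  else fun=> 0.

Lemma rows_from_below_spec D n k :
  nonincreasing_seq (rows_from_below D n k) /\
  exists m, forall j, m <= j -> rows_from_below D n k j = 0.
Proof.
elim: k => [|k [dec [m fin]]]; first by split=> //; exists 0.
split; first exact: add_row_nonincreasing (row_parts_sorted _ _) dec.
exists (m + size (row_parts (D (n - k.+1)) n)).
exact: add_row_eq0 (row_parts_sorted _ _) (row_parts_gt0 _ _) fin.
Qed.

Lemma descent_mx_surj : finsupp_mx `<=` descent_mx @` plane_partition.
Proof.
move=> D [n Dn]; pose row := rows_from_below D n; pose pi i := row (n - i).
have row_dec k : nonincreasing_seq (row k) by case: (rows_from_below_spec D n k).
have row_leS k j : row k j <= row k.+1 j by exact: add_row_geq.
have row_le k k' j : k <= k' -> row k j <= row k' j.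
  move=> /subnKC <-; elim: (k' - k) => [|d IHd]; first by rewrite addn0.
  by rewrite addnS (leq_trans IHd).
have [m fin] : exists m, forall j, m <= j -> row n j = 0.
  by case: (rows_from_below_spec D n n).
have pi_box : in_box (n + m) pi.
  move=> i j /orP[ni|mj]; first by rewrite /pi (_ : n - i = 0) //; lia.
  by apply/eqP; rewrite -leqn0 -(fin j) ?row_le ?leq_subr //; lia.
exists pi.
  apply/plane_partitionP; split=> [|i j|i]; first by exists (n + m).
    by apply: row_le; lia.
  exact: row_dec.
apply/funext => i; apply/funext => l.
have [ni|ni] := leqP n i.
  rewrite Dn ?ni // (descent_mx_box _ _ pi_box) /pi.
  by apply: big1 => j _; rewrite (_ : n - i = 0) //; lia.
have rowE : pi i = add_row (row_parts (D i) n) (pi i.+1).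
  rewrite /pi (_ : n - i = (n - i.+1).+1); last by lia.
  by rewrite /row /= (_ : n - (n - i.+1).+1 = i) //; lia.
have [M finM] : exists M, forall j, M <= j -> pi i.+1 j = 0.
  by case: (rows_from_below_spec D n (n - i.+1)).
(* [N] lies beyond the box of [pi] and beyond the column by which the greedy row has consumed every
   part. *)
pose N := n + m + (M + size (row_parts (D i) n)).
have piN : in_box N pi by apply: in_boxW pi_box; lia.
rewrite (descent_mx_box _ _ piN) rowE (descent_count_add_row (n := M)) //.
- by apply: count_row_parts => k nk; rewrite Dn // nk orbT.
- exact: row_parts_sorted.
- exact: row_parts_gt0.
- by rewrite /N; lia.
Qed.

Lemma descent_mx_bij : set_bij plane_partition finsupp_mx descent_mx.
Proof.
split; [|exact: descent_mx_inj|exact: descent_mx_surj].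
move=> pi Ppi; have [n [pin len]] := plane_partition_box Ppi.
by exists n; exact: in_box_descent_mx.
Qed.

(** * Local rules and growth diagrams *)

Definition interlace (lam mu : nat -> nat) := forall r, mu r <= lam r /\ lam r.+1 <= mu r.

(** Reflects [lam r.+1] in the interval from max(mu_{r+1}, nu_{r+1}) to min(mu_r, nu_r). If [lam]
    interlaces with both, it lies in this interval: the subtraction is exact, and the reflected
    value interlaces in turn. *)
Definition toggle_down (lam mu nu : nat -> nat) r :=
  maxn (mu r.+1) (nu r.+1) + minn (mu r) (nu r) - lam r.+1.

(** Solves the same rule for the north-west partition; its part 0, which the rule leaves free, is
    fixed by the corner entry [b]. *)
Definition toggle_up b (kap mu nu : nat -> nat) r :=
  if r is s.+1 then maxn (mu s.+1) (nu s.+1) + minn (mu s) (nu s) - kap s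
  else maxn (mu 0) (nu 0) + b.

Lemma interlace_down lam mu nu : interlace lam mu -> interlace lam nu ->
  interlace mu (toggle_down lam mu nu) /\ interlace nu (toggle_down lam mu nu).
Proof.
move=> lm ln; split=> r; rewrite /toggle_down; move: (lm r) (ln r) (lm r.+1) (ln r.+1); lia.
Qed.

Lemma interlace_up b kap mu nu : interlace mu kap -> interlace nu kap ->
  interlace (toggle_up b kap mu nu) mu /\ interlace (toggle_up b kap mu nu) nu.
Proof.
move=> mk nk; split=> -[|r] /=; move: (mk 0) (nk 0); rewrite /toggle_up.
- lia.
- move: (mk r) (nk r) (mk r.+1) (nk r.+1); lia.
- lia.
- move: (mk r) (nk r) (mk r.+1) (nk r.+1); lia.
Qed.

(** [V i j] and [H i j] stand for the vertical and horizontal edges leaving (i, j); a step passes to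
    the two edges entering (i + 1, j + 1), following the local rule. *)
Lemma grid_ind (V H : nat -> nat -> Prop) :
  (forall i, V i 0) -> (forall j, H 0 j) ->
  (forall i j, V i j -> H i j -> V i j.+1 /\ H i.+1 j) ->
  forall i j, V i j /\ H i j.
Proof.
move=> V0 H0 step; have VH i : (forall j, H i j) -> forall j, V i j.
  by move=> Hi; elim=> [|j /step[]].
have Hall i : forall j, H i j.
  by elim: i => // i IHi j; have [] := step i j (VH i IHi j) (IHi j).
by move=> i j; split=> //; exact: VH.
Qed.

(* The partitions of a growth diagram, for a grid whose entries decrease
   towards the south-east. *)
Record growth (L : nat -> nat -> nat -> nat) := Growth {
  growth_v : forall i j, interlace (L i j) (L i.+1 j);
  growth_h : forall i j, interlace (L i j) (L i j.+1);
  growth_rule : forall i j r, L i.+1 j.+1 r + L i j r.+1 =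
    maxn (L i.+1 j r.+1) (L i j.+1 r.+1) + minn (L i.+1 j r) (L i j.+1 r) }.

Definition growth_corner (L : nat -> nat -> nat -> nat) i j :=
  L i j 0 - maxn (L i.+1 j 0) (L i j.+1 0).

Definition vanishes n (L : nat -> nat -> nat -> nat) :=
  forall i j r, [|| n <= i, n <= j | n <= r] -> L i j r = 0.

Lemma growth_corner_box n L : vanishes n L -> in_box n (growth_corner L).
Proof.
by move=> Ln i j nij; rewrite /growth_corner Ln //; case/orP: nij => ->; rewrite ?orbT.
Qed.

Lemma growth_cornerE L i j : growth L ->
  L i j 0 = growth_corner L i j + maxn (L i.+1 j 0) (L i j.+1 0).
Proof.
move=> gL; rewrite /growth_corner; move: (growth_v gL i j 0) (growth_h gL i j 0); lia.
Qed.

(** Downward induction on i + j, from the region where both diagrams vanish: part 0 comes from the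
    corner entry, the later parts from the local rule and the three neighbours to the south and
    east. *)
Lemma growth_inj n L L' : growth L -> growth L' -> vanishes n L -> vanishes n L' ->
  growth_corner L = growth_corner L' -> L = L'.
Proof.
move=> gL gL' Ln L'n eq_corner.
suff eqL d : forall i j, n + n <= i + j + d -> L i j =1 L' i j.
  by do 3![apply/funext => ?]; apply: (eqL (n + n)); rewrite leq_addl.
elim: d => [|d IHd] i j nd.
  by move=> r; rewrite Ln ?L'n //; lia.
have e1 := IHd i.+1 j; have e2 := IHd i j.+1; have e3 := IHd i.+1 j.+1.
move=> [|r].
  by rewrite (growth_cornerE i j gL) (growth_cornerE i j gL') eq_corner e1 ?e2 //; lia.
move: (growth_rule gL i j r) (growth_rule gL' i j r).
rewrite !e1 ?e2 ?e3; lia.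
Qed.

(** Here the rule is solved for the south-east partition of each square. *)
Lemma growth_boundary L L' : growth L -> growth L' ->
  (forall i, L i 0 = L' i 0) -> (forall j, L 0 j = L' 0 j) -> L = L'.
Proof.
move=> gL gL' eq0 eq0'; suff eqL i j : L i j =1 L' i j.
  by do 3![apply/funext => ?]; exact: eqL.
elim: i j => [|i IHi] j; first by rewrite eq0'.
elim: j => [|j IHj] r; first by rewrite eq0.
move: (growth_rule gL i j r) (growth_rule gL' i j r).
rewrite !IHi !IHj; lia.
Qed.

Definition growth_size n (L : nat -> nat -> nat -> nat) i j := \sum_(r < n) L i j r.

(** The local rule is summed over [r], using max + min = sum of the two; the shift from [r] to
    [r.+1] leaves the terms of index 0, whose difference is the corner entry. *)
Lemma growth_size_step n L i j : growth L -> vanishes n L ->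
  growth_size n L i j + growth_size n L i.+1 j.+1 =
  growth_size n L i.+1 j + growth_size n L i j.+1 + growth_corner L i j.
Proof.
move=> gL Ln; have shift f : f n = 0 -> \sum_(r < n) f r = f 0 + \sum_(r < n) f r.+1.
  move=> fn; transitivity (\sum_(r < n.+1) f r); last by rewrite big_ord_recl.
  by rewrite big_ord_recr /= fn addn0.
have : \sum_(r < n) (L i.+1 j.+1 r + L i j r.+1) =
    \sum_(r < n) (maxn (L i.+1 j r.+1) (L i j.+1 r.+1) + minn (L i.+1 j r) (L i j.+1 r)).
  by apply: eq_bigr => r _; exact: growth_rule.
rewrite !big_split /= => rule.
have sum_max_min (f g : nat -> nat) : \sum_(r < n) maxn (f r) (g r) +
    \sum_(r < n) minn (f r) (g r) = \sum_(r < n) f r + \sum_(r < n) g r.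
  by rewrite -!big_split; apply: eq_bigr => r _ /=; lia.
have Ln0 i' j' : L i' j' n = 0 by rewrite Ln ?leqnn ?orbT.
have max0 : maxn (L i.+1 j n) (L i j.+1 n) = 0 by rewrite !Ln0.
move: (sum_max_min (L i.+1 j) (L i j.+1)) (shift _ (Ln0 i j)).
move: (shift (fun r => maxn (L i.+1 j r) (L i j.+1 r)) max0) (growth_cornerE i j gL).
rewrite /growth_size; move=> /= *; lia.
Qed.

(** [growth_size_step] is telescoped twice: along a row it gives the difference of sizes between
    rows [i] and [i.+1], then along a column the size itself. *)
Lemma growth_sizeE n L k l : growth L -> vanishes n L ->
  growth_size n L k l = \sum_(k <= i < n) \sum_(l <= j < n) growth_corner L i j.
Proof.
move=> gL Ln; have size0 i j : (n <= i) || (n <= j) -> growth_size n L i j = 0.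
  by move=> nij; apply: big1 => r _; rewrite Ln // orbA nij.
have row i d : forall j, n <= j + d -> growth_size n L i j =
    growth_size n L i.+1 j + \sum_(j <= j' < n) growth_corner L i j'.
  elim: d => [|d IHd] j jd.
    by rewrite big_geq ?size0 //; lia.
  have [nj|jn] := leqP n j; first by rewrite big_geq ?size0 ?nj ?orbT.
  have := growth_size_step i j gL Ln; rewrite big_ltn // (IHd j.+1) //; lia.
suff H d : forall i, n <= i + d ->
    growth_size n L i l = \sum_(i <= i' < n) \sum_(l <= j < n) growth_corner L i' j.
  by apply: (H n); rewrite leq_addl.
elim: d => [|d IHd] i id; first by rewrite big_geq ?size0 //; lia.
have [ni|lt_in] := leqP n i; first by rewrite big_geq ?size0 ?ni.
by rewrite big_ltn // (row _ n) ?leq_addl // IHd; lia.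
Qed.

(** * Sums over triangles and diagonals *)

Lemma sum_triangle n (f : nat -> nat) :
  \sum_(k < n) \sum_(k <= j < n) f j = \sum_(j < n) f j * j.+1.
Proof.
elim: n => [|n IHn]; first by rewrite !big_ord0.
rewrite !big_ord_recr /= big_nat1 -IHn.
rewrite (eq_bigr (fun k : 'I_n => \sum_(k <= j < n) f j + f n)); last first.
  by move=> k _; rewrite big_nat_recr // ltnW.
by rewrite big_split sum_nat_const card_ord /=; lia.
Qed.

Lemma sum_strict_triangle n (f : nat -> nat) :
  \sum_(k < n) \sum_(k.+1 <= j < n) f j = \sum_(j < n) f j * j.
Proof.
elim: n => [|n IHn]; first by rewrite !big_ord0.
rewrite !big_ord_recr /= big_geq // addn0 -IHn.
rewrite (eq_bigr (fun k : 'I_n => \sum_(k.+1 <= j < n) f j + f n)); last first.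
  by move=> k _; rewrite big_nat_recr.
by rewrite big_split sum_nat_const card_ord /=; lia.
Qed.

Lemma sum_square_triangles n (f : nat -> nat -> nat) :
  \sum_(i < n) \sum_(j < n) f i j =
  \sum_(i < n) \sum_(i <= j < n) f i j + \sum_(j < n) \sum_(j.+1 <= i < n) f i j.
Proof.
under [X in _ = X + _]eq_bigr do rewrite big_geq_mkord /=.
under [X in _ = _ + X]eq_bigr do rewrite big_geq_mkord /=.
rewrite [X in _ = _ + X](exchange_big_dep xpredT) //= -big_split /=.
apply: eq_bigr => i _; rewrite (bigID (fun j : 'I_n => i <= j)) /=.
by congr addn; apply: eq_bigl => j; rewrite -ltnNge.
Qed.

(** The cells with column at least the row are summed along diagonals of offset [k], the cells below
    the main diagonal along those of offset [k.+1]. *)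
Lemma volume_diagonals n pi : in_box n pi ->
  volume pi = \sum_(k < n) \sum_(r < n) pi r (r + k) +
              \sum_(k < n) \sum_(r < n) pi (r + k.+1) r.
Proof.
move=> pin; rewrite (volume_box pin) sum_square_triangles.
(* The two ranges differ only by indices at least [n], where [f] vanishes. *)
have shift f m : (forall j, n <= j -> f j = 0) ->
    \sum_(m <= j < n) f j = \sum_(k < n) f (m + k).
  move=> fn; rewrite -(big_mkord xpredT (fun k => f (m + k))).
  have [nm|mn] := leqP n m.
    by rewrite big_geq // big1_seq // => k _; rewrite fn //; lia.
  have le_n : n - m <= n by exact: leq_subr.
  rewrite (big_cat_nat (leq0n _) le_n) /= [X in _ + X]big_nat_cond [X in _ + X]big1 ?addn0.
    by rewrite -{1}[m]add0n big_addn; apply: eq_bigr => k _; rewrite addnC.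
  by move=> k /andP[/andP[nk _] _]; rewrite fn //; lia.
congr addn.
  rewrite [RHS]exchange_big; apply: eq_bigr => r _; apply: (shift (pi r)) => j nj.
  by rewrite pin // nj orbT.
rewrite [RHS]exchange_big; apply: eq_bigr => r _.
rewrite (shift (pi^~ r)); first by apply: eq_bigr => k _; rewrite addSnnS.
by move=> i ni; rewrite pin ?ni.
Qed.

(** * Growth diagram of a plane partition *)

Fixpoint diagonal_growth (pi : nat -> nat -> nat) i : nat -> nat -> nat :=
  if i is i'.+1 then
    fix row j := if j is j'.+1 then
      toggle_down (diagonal_growth pi i' j') (row j') (diagonal_growth pi i' j)
    else fun r => pi (r + i) r
  else fun j r => pi r (r + j).

Lemma diagonal_growth_row pi j r : diagonal_growth pi 0 j r = pi r (r + j).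
Proof. by []. Qed.

Lemma diagonal_growth_col pi i r : diagonal_growth pi i 0 r = pi (r + i) r.
Proof. by case: i => [|i] //=; rewrite addn0. Qed.

Lemma diagonal_growthS pi i j : diagonal_growth pi i.+1 j.+1 =
  toggle_down (diagonal_growth pi i j) (diagonal_growth pi i.+1 j) (diagonal_growth pi i j.+1).
Proof. by []. Qed.

(** Neighbouring diagonals of a plane partition interlace, and [toggle_down] carries interlacing
    across the grid. *)
Lemma diagonal_growthP pi : plane_partition pi -> growth (diagonal_growth pi).
Proof.
move=> /plane_partitionP[_ dec1 dec2].
pose V i j := interlace (diagonal_growth pi i j) (diagonal_growth pi i.+1 j).
pose H i j := interlace (diagonal_growth pi i j) (diagonal_growth pi i j.+1).
have VH : forall i j, V i j /\ H i j.
  apply: grid_ind => [i r|j r|i j v h].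
  - by rewrite !diagonal_growth_col addnS addSn; split=> //; exact: dec2.
  - by rewrite !diagonal_growth_row addnS addSn; split=> //; exact: dec2.
  - by rewrite and_comm; exact: interlace_down.
split=> [i j|i j|i j r]; [by have [] := VH i j | by have [] := VH i j |].
have [v h] := VH i j; move: (v r) (h r) (v r.+1) (h r.+1).
rewrite diagonal_growthS /toggle_down; lia.
Qed.

(** By interlacing, each part weakly decreases along the grid, hence is bounded by parts on the
    boundary, which are entries of [pi]. *)
Lemma vanishes_diagonal_growth n pi : plane_partition pi -> in_box n pi ->
  vanishes n (diagonal_growth pi).
Proof.
move=> /diagonal_growthP gpi pin i j r nijr; apply/eqP; rewrite -leqn0.
have le_i i' : diagonal_growth pi i' j r <= diagonal_growth pi 0 j r.
  elim: i' => // i' IHi; apply: leq_trans IHi; exact: (growth_v gpi _ _ _).1.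
have le_j j' : diagonal_growth pi i j' r <= diagonal_growth pi i 0 r.
  elim: j' => // j' IHj; apply: leq_trans IHj; exact: (growth_h gpi _ _ _).1.
move: (le_i i) (le_j j); rewrite diagonal_growth_row diagonal_growth_col.
case/or3P: nijr => nr.
- by rewrite (pin (r + i)) //; lia.
- by rewrite (pin r (r + j)) //; lia.
- by rewrite (pin (r + i)) //; lia.
Qed.

Definition toggle_mx pi := growth_corner (diagonal_growth pi).

(** The partition at (0, 0) is the main diagonal: its size is the trace, and by [growth_sizeE] also
    the sum of all matrix entries. *)
Lemma volume_toggle_mx pi : plane_partition pi -> volume (toggle_mx pi) = trace pi.
Proof.
move=> Ppi; have [[n pin] _ _] := (plane_partitionP pi).1 Ppi.
have van := vanishes_diagonal_growth Ppi pin.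
rewrite (volume_box (growth_corner_box van)).
have := growth_sizeE 0 0 (diagonal_growthP Ppi) van; rewrite big_mkord.
under eq_bigr do rewrite big_mkord; move=> <-.
rewrite /trace (@fsum_lt n); last by move=> i ni; rewrite pin ?ni.
by apply: eq_bigr => r _; rewrite diagonal_growth_row addn0.
Qed.

(** The volume is the sum of the sizes of the boundary partitions. By [growth_sizeE] the entry at
    (i, j) is counted in the j + 1 diagonals of offsets 0 to j in the first row and in the i
    diagonals of offsets 1 to i in the first column. *)
Lemma weight_toggle_mx pi : plane_partition pi -> weight (toggle_mx pi) = volume pi.
Proof.
move=> Ppi; have [[n pin] _ _] := (plane_partitionP pi).1 Ppi.
have van := vanishes_diagonal_growth Ppi pin; have gpi := diagonal_growthP Ppi.
rewrite (weight_box (growth_corner_box van)) (volume_diagonals pin).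
rewrite -[X in _ = X + _]/(\sum_(k < n) growth_size n (diagonal_growth pi) 0 k).
under [X in _ = X + _]eq_bigr do rewrite growth_sizeE // big_mkord.
rewrite [X in _ = X + _]exchange_big /=.
under [X in _ = X + _]eq_bigr do rewrite sum_triangle.
have -> : \sum_(k < n) \sum_(r < n) pi (r + k.+1) r =
    \sum_(k < n) \sum_(k.+1 <= i < n) \sum_(j < n) toggle_mx pi i j.
  apply: eq_bigr => k _; under [RHS]eq_bigr do rewrite -(big_mkord xpredT).
  by rewrite -growth_sizeE //; apply: eq_bigr => r _; rewrite diagonal_growth_col.
rewrite sum_strict_triangle -big_split; apply: eq_bigr => i _ /=.
rewrite big_distrl -big_split; apply: eq_bigr => j _ /=; rewrite /toggle_mx; lia.
Qed.

Lemma toggle_mx_inj : {in plane_partition &, injective toggle_mx}.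
Proof.
move=> pi pi'; rewrite !inE => Ppi Ppi' eq_mx.
have [[m pim] _ _] := (plane_partitionP pi).1 Ppi.
have [[m' pim'] _ _] := (plane_partitionP pi').1 Ppi'.
have pin : in_box (maxn m m') pi by apply: in_boxW pim; lia.
have pin' : in_box (maxn m m') pi' by apply: in_boxW pim'; lia.
have eqL := growth_inj (diagonal_growthP Ppi) (diagonal_growthP Ppi')
  (vanishes_diagonal_growth Ppi pin) (vanishes_diagonal_growth Ppi' pin') eq_mx.
apply/funext => i; apply/funext => j; have [ij|/ltnW ji] := leqP i j.
  by rewrite -(subnKC ij) -!diagonal_growth_row eqL.
by rewrite -(subnKC ji) -!diagonal_growth_col eqL.
Qed.

(** * Plane partition with a given toggle matrix *)

Fixpoint growth_of (b : nat -> nat -> nat) i : nat -> nat -> nat :=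
  if i is i'.+1 then
    fix row j := if j is j'.+1 then
      toggle_up (b i' j') (growth_of b i' j') (row j') (growth_of b i' j)
    else fun=> 0
  else fun _ _ => 0.

Lemma growth_of_col0 b i r : growth_of b i 0 r = 0. Proof. by case: i. Qed.

Lemma growth_of_interlace b i j :
  interlace (growth_of b i.+1 j) (growth_of b i j) /\
  interlace (growth_of b i j.+1) (growth_of b i j).
Proof.
move: i j; apply: grid_ind => [i r|j r|i j v h]; rewrite ?growth_of_col0 //.
by rewrite and_comm; exact: interlace_up.
Qed.

(** By interlacing, a step from row [i] to [i.+1] adds at most one part. *)
Lemma growth_of_eq0 b i j r : i <= r -> growth_of b i j r = 0.
Proof.
elim: i r => // i IHi [|r] //; rewrite ltnS => /IHi r0; apply/eqP.
by rewrite -leqn0 -[X in _ <= X]r0; exact: ((growth_of_interlace b i j).1 r).2.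
Qed.

Lemma toggle_mx_surj : finsupp_mx `<=` toggle_mx @` plane_partition.
Proof.
(* [growth_of] starts from empty partitions in row and column 0, whereas the diagram sought is empty
   from index [n] on; so both indices are reversed, in the matrix and in the diagram. *)
move=> a [n an]; pose b i j := a (n - i.+1) (n - j.+1).
pose L i j := growth_of b (n - i) (n - j).
have nS i : i < n -> n - i = (n - i.+1).+1 by lia.
have L0 i j r : (n <= i) || (n <= j) -> L i j r = 0.
  rewrite /L => /orP[ni|nj]; first by rewrite (_ : n - i = 0) //; lia.
  by rewrite (_ : n - j = 0) ?growth_of_col0 //; lia.
have L_interlace i j : interlace (L i j) (L i.+1 j) /\ interlace (L i j) (L i j.+1).
  have [nij|] := boolP ((n <= i) || (n <= j)).
    by split=> r; rewrite !L0 //; lia.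
  rewrite negb_or -!ltnNge => /andP[ni nj].
  rewrite /L (nS i ni) (nS j nj).
  by split; [exact: (growth_of_interlace _ _ _).1 | exact: (growth_of_interlace _ _ _).2].
have LE i j : i < n -> j < n ->
    L i j = toggle_up (a i j) (L i.+1 j.+1) (L i j.+1) (L i.+1 j).
  move=> ni nj; rewrite {1}/L (nS i ni) (nS j nj) /= {1}/b.
  have -> : n - (n - i.+1).+1 = i by lia.
  have -> : n - (n - j.+1).+1 = j by lia.
  by rewrite /L (nS i ni) (nS j nj).
have gL : growth L.
  split=> [i j|i j|i j r]; [by have [] := L_interlace i j | by have [] := L_interlace i j |].
  have [nij|] := boolP ((n <= i) || (n <= j)); first by rewrite !L0 //; lia.
  rewrite negb_or -!ltnNge => /andP[ni nj].
  move: ((L_interlace i j.+1).1 r) ((L_interlace i.+1 j).2 r).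
  by rewrite (LE i j) // /toggle_up; lia.
(* The entry (r, s) is part min(r, s) of the boundary partition that belongs to its diagonal. *)
pose pi r s := if r <= s then L 0 (s - r) r else L (r - s) 0 s.
have Ppi : plane_partition pi.
  apply/plane_partitionP; split.
  (* Outside this box either the smaller coordinate is at least [n], beyond the length of the
     partition, or the offset of the diagonal is. *)
  - exists (n + n) => r s nrs; rewrite /pi; case: leqP => rs.
      have [nr|rn] := leqP n r; first by rewrite /L growth_of_eq0 //; lia.
      by rewrite L0 //; lia.
    have [ns|sn] := leqP n s; first by rewrite /L growth_of_eq0 //; lia.
    by rewrite L0 //; lia.
  - move=> r s; rewrite /pi; case: (ltngtP r s) => [rs|sr|->].
    + rewrite (_ : s - r = (s - r.+1).+1); last by lia.
      exact: (growth_h gL 0 (s - r.+1) r).2.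
    + rewrite (_ : r.+1 - s = (r - s).+1); last by lia.
      exact: (growth_v gL (r - s) 0 s).1.
    + by rewrite subnn subSn // subnn; exact: (growth_v gL 0 0 s).1.
  - move=> r s; rewrite /pi; case: (ltngtP r s.+1) => [rs|sr|->].
    + have le_rs : r <= s by [].
      rewrite le_rs subSn //.
      exact: (growth_h gL 0 (s - r) r).1.
    + rewrite (_ : (r <= s) = false); last by lia.
      rewrite (_ : r - s = (r - s.+1).+1); last by lia.
      exact: (growth_v gL (r - s.+1) 0 s).2.
    + rewrite ltnn subnn subSn // subnn.
      exact: (growth_v gL 0 0 s).2.
(* [L] and [diagonal_growth pi] have the same first row and column, so [growth_boundary] identifies
   them; the corner entries of [L] are those of [a]. *)
exists pi => //; rewrite /toggle_mx (_ : diagonal_growth pi = L).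
  apply/funext => i; apply/funext => j; rewrite /growth_corner.
  have [nij|] := boolP ((n <= i) || (n <= j)); first by rewrite !L0 ?an //; lia.
  rewrite negb_or -!ltnNge => /andP[ni nj].
  by rewrite (LE i j) // /toggle_up maxnC; lia.
apply: growth_boundary => //; first exact: diagonal_growthP.
  move=> i; apply/funext => r; rewrite diagonal_growth_col /pi.
  have -> : r + i - r = i by lia.
  by case: i => [|i]; rewrite ?addn0 ?leqnn ?subnn // (_ : (r + i.+1 <= r) = false); lia.
move=> j; apply/funext => r; rewrite diagonal_growth_row /pi leq_addr.
by have -> : r + j - r = j by lia.
Qed.

Lemma toggle_mx_bij : set_bij plane_partition finsupp_mx toggle_mx.
Proof.
split; [|exact: toggle_mx_inj|exact: toggle_mx_surj].
move=> pi Ppi; have [n [pin _]] := plane_partition_box Ppi.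
by exists n; apply: growth_corner_box; exact: vanishes_diagonal_growth.
Qed.

(** * The two equidistributions *)

Local Open Scope ring_scope.

Lemma equidistribution (R : comUnitRingType) (tau : R) :
  let t : fps R := fps_const tau in
  let q : fps R := fps_var in
  let u k := 1 / (1 - t * q ^+ k) ^+ k in
  let F pi := t ^+ des pi * q ^+ uh_volume pi in
  let G pi := t ^+ trace pi * q ^+ volume pi in
  [/\ fps_summable plane_partition F,
      fps_multipliable u,
      fps_summable plane_partition G,
      fps_sum plane_partition F = fps_prod u
    & fps_prod u = fps_sum plane_partition G].
Proof.
move=> t q u F G.
have uE : u = macmahon_factor tau by rewrite /macmahon_factor /monomial expr1.
have [sumF eqF] := gf_bij tau descent_mx_bij
  (fun pi Ppi => conj (volume_descent_mx Ppi) (weight_descent_mx Ppi)).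
have [sumG eqG] := gf_bij tau toggle_mx_bij
  (fun pi Ppi => conj (volume_toggle_mx Ppi) (weight_toggle_mx Ppi)).
rewrite uE; split=> //; exact: (fps_prod_gf tau).1.
Qed.

Theorem corollary6p4 :
  (let q : fps int := fps_var in
   let u k := 1 / (1 - q ^+ k) ^+ k in
   let F pi := q ^+ uh_volume pi in
   let G pi := q ^+ volume pi in
   [/\ fps_summable plane_partition F,
       fps_multipliable u,
       fps_summable plane_partition G,
       fps_sum plane_partition F = fps_prod u
     & fps_prod u = fps_sum plane_partition G])
  /\
  (let t : fps (fps int) := fps_const fps_var in
   let q : fps (fps int) := fps_var in
   let u k := 1 / (1 - t * q ^+ k) ^+ k in
   let F pi := t ^+ des pi * q ^+ uh_volume pi in
   let G pi := t ^+ trace pi * q ^+ volume pi in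
   [/\ fps_summable plane_partition F,
       fps_multipliable u,
       fps_summable plane_partition G,
       fps_sum plane_partition F = fps_prod u
     & fps_prod u = fps_sum plane_partition G]).
Proof.
split; last exact: (@equidistribution (fps int) fps_var).
(* The identity in q alone is the case t = 1, where the powers of t drop out. *)
have unit_const m (f : fps int) : fps_const 1 ^+ m * f = f.
  by rewrite -[fps_const 1]/(1 : fps int) expr1n mul1r.
have eq_u : (fun k => 1 / (1 - fps_const 1 * fps_var ^+ k) ^+ k) =
    (fun k => 1 / (1 - fps_var ^+ k) ^+ k) :> (nat -> fps int).
  by apply/funext => k; rewrite -[fps_const 1]expr1 unit_const.
have eq_F (stat1 stat2 : (nat -> nat -> nat) -> nat) :
    (fun pi => fps_const 1 ^+ stat1 pi * fps_var ^+ stat2 pi) =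
    (fun pi => fps_var ^+ stat2 pi) :> (_ -> fps int).
  by apply/funext => pi; exact: unit_const.
by have := @equidistribution int 1; cbv zeta; rewrite eq_u !eq_F.
Qed.
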